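(* Let $\mathfrak{L}$ be a left Leibniz algebra over a field $\mathbb{F}$. If $M$ and $N$ are weak $\mathfrak{L}$-bimodules, then $M\otimes N$, endowed with the left and right $\mathfrak{L}$-actions $$x\cdot(m\otimes n):=(x\cdot m)\otimes n+m\otimes(x\cdot n),\qquad (m\otimes n)\cdot x:=(m\cdot x)\otimes n+m\otimes(n\cdot x)$$ for $x\in\mathfrak{L}$, $m\in M$, $n\in N$, is a weak $\mathfrak{L}$-bimodule.
   Context: Tensor products are over the ground field $\mathbb{F}$ (arbitrary). A left Leibniz algebra is an $\mathbb{F}$-vector space $\mathfrak{L}$ with a bilinear multiplication satisfying $x(yz)=(xy)z+y(xz)$ for all $x,y,z\in\mathfrak{L}$. A weak $\mathfrak{L}$-bimodule is an $\mathbb{F}$-vector space $M$ with bilinear left and right $\mathfrak{L}$-actions satisfying, for all $x,y\in\mathfrak{L}$, $m\in M$: (LLM) $(xy)\cdot m=x\cdot(y\cdot m)-y\cdot(x\cdot m)$; (LML) $(x\cdot m)\cdot y=x\cdot(m\cdot y)-m\cdot(xy)$. *)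

(* Defs.v *)
From HB Require Import structures.
From mathcomp Require Import all_boot all_order all_algebra ring_quotient.
From mathcomp Require Import boolp.
From mathcomp.multinomials Require Import freeg.

Set Implicit Arguments.
Unset Strict Implicit.
Unset Printing Implicit Defensive.

Import GRing.Theory.
Local Open Scope ring_scope.
Local Open Scope quotient_scope.

Section LeibnizBimodules.
Variables (F : fieldType) (L : lmodType F) (mul : {bilinear L -> L -> L}).

Definition left_leibniz : Prop :=
  forall x y z : L, mul x (mul y z) = mul (mul x y) z + mul y (mul x z).

Variables (M : lmodType F).
Variables (l : {bilinear L -> M -> M}) (r : {bilinear M -> L -> M}).

Definition LLM : Prop :=
  forall (x y : L) (m : M), l (mul x y) m = l x (l y m) - l y (l x m).

Definition LML : Prop :=
  forall (x y : L) (m : M), r (l x m) y = l x (r m y) - r m (mul x y).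

Definition weak_bimodule : Prop := LLM /\ LML.

End LeibnizBimodules.

(* The tensor product of two arbitrary vector spaces, as the free vector space
   on [M * N] modulo the subspace spanned by the bilinearity relations. *)
Section TensorProduct.
Variables (F : fieldType) (M N : lmodType F).

Let free := {freeg (M * N)%type / F}.
Let pair (m : M) (n : N) : free := << (m, n) >>.

Inductive tensor_rel : {freeg (M * N)%type / F} -> Prop :=
| TensorRel0 : tensor_rel 0
| TensorRelD u v : tensor_rel u -> tensor_rel v -> tensor_rel (u + v)
| TensorRelZ a u : tensor_rel u -> tensor_rel (a *: u)
| TensorRelDl m m' n : tensor_rel (pair (m + m') n - pair m n - pair m' n)
| TensorRelDr m n n' : tensor_rel (pair m (n + n') - pair m n - pair m n')
| TensorRelZl a m n : tensor_rel (pair (a *: m) n - a *: pair m n)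
| TensorRelZr a m n : tensor_rel (pair m (a *: n) - a *: pair m n).

Definition tensor_relb : {pred {freeg (M * N)%type / F}} :=
  fun u => `[< tensor_rel u >].

Lemma tensor_relP u : reflect (tensor_rel u) (u \in tensor_relb).
Proof. exact: asboolP. Qed.

Fact tensor_rel_closed : zmod_closed tensor_relb.
Proof.
split=> [|u v /tensor_relP hu /tensor_relP hv]; apply/tensor_relP.
  exact: TensorRel0.
by rewrite -scaleN1r; apply: TensorRelD => //; apply: TensorRelZ.
Qed.

HB.instance Definition _ := GRing.isZmodClosed.Build _ tensor_relb
  tensor_rel_closed.

Definition tensor : Type := Quotient.quot tensor_relb.
HB.instance Definition _ := GRing.Zmodule.on tensor.

Definition tensor_pi (u : {freeg (M * N)%type / F}) : tensor :=
  \pi_(Quotient.quot tensor_relb) u.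

Lemma tensor_piP u v : tensor_pi u = tensor_pi v <-> tensor_rel (u - v).
Proof.
rewrite /tensor_pi; split=> [/eqP|h].
  by rewrite -Quotient.idealrBE => /tensor_relP.
by apply/eqP; rewrite -Quotient.idealrBE; apply/tensor_relP.
Qed.

Lemma tensor_reprK (t : tensor) :
  tensor_pi (repr (t : Quotient.quot tensor_relb)) = t.
Proof. exact: reprK. Qed.

Lemma tensor_piD u v : tensor_pi (u + v) = tensor_pi u + tensor_pi v.
Proof. exact: raddfD. Qed.

Definition tensor_scale (a : F) (t : tensor) : tensor :=
  tensor_pi (a *: repr (t : Quotient.quot tensor_relb)).

Lemma tensor_piZ a u : tensor_pi (a *: u) = tensor_scale a (tensor_pi u).
Proof.
by apply/tensor_piP; rewrite -scalerBr; apply/TensorRelZ/tensor_piP;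
  rewrite tensor_reprK.
Qed.

Fact tensor_scaleA a b t :
  tensor_scale a (tensor_scale b t) = tensor_scale (a * b) t.
Proof. by rewrite -[t]tensor_reprK -!tensor_piZ scalerA. Qed.

Fact tensor_scale1 t : tensor_scale 1 t = t.
Proof. by rewrite -[t]tensor_reprK -!tensor_piZ scale1r. Qed.

Fact tensor_scaleDr : right_distributive tensor_scale +%R.
Proof.
move=> a s t; rewrite -[s]tensor_reprK -[t]tensor_reprK.
by rewrite -tensor_piD -!tensor_piZ -tensor_piD scalerDr.
Qed.

Fact tensor_scaleDl t : {morph tensor_scale^~ t : a b / a + b}.
Proof.
move=> a b; rewrite -[t]tensor_reprK -!tensor_piZ -tensor_piD.
by rewrite scalerDl.
Qed.

HB.instance Definition _ := GRing.Zmodule_isLmodule.Build F tensor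
  tensor_scaleA tensor_scale1 tensor_scaleDr tensor_scaleDl.

Fact tensor_pi_linear : linear tensor_pi.
Proof. by move=> a u v; rewrite tensor_piD tensor_piZ. Qed.
HB.instance Definition _ := GRing.isLinear.Build F _ tensor _ tensor_pi
  tensor_pi_linear.

Definition tens (m : M) (n : N) : tensor := tensor_pi << (m, n) >>.

Fact tens_bilinear : bilinear_for *:%R *:%R tens.
Proof.
have eqD u v w :
    tensor_rel (u - v - w) -> tensor_pi u = tensor_pi v + tensor_pi w.
  by move=> h; rewrite -tensor_piD; apply/tensor_piP; rewrite opprD addrA.
have eqZ a u v : tensor_rel (u - a *: v) -> tensor_pi u = a *: tensor_pi v.
  by move=> h; rewrite -[RHS]tensor_piZ; apply/tensor_piP.
split=> [n a m m'|m a n n'] /=.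
  by rewrite /tens (eqD _ _ _ (TensorRelDl _ _ _))
    (eqZ _ _ _ (TensorRelZl _ _ _)).
by rewrite /tens (eqD _ _ _ (TensorRelDr _ _ _))
  (eqZ _ _ _ (TensorRelZr _ _ _)).
Qed.
HB.instance Definition _ := bilinear_isBilinear.Build F M N tensor
  _ _ tens tens_bilinear.

Lemma tensor_ind (P : tensor -> Prop) :
  P 0 -> (forall s t, P s -> P t -> P (s + t)) -> (forall m n, P (tens m n)) ->
  forall t, P t.
Proof.
move=> P0 PD Pt t; rewrite -[t]tensor_reprK.
elim/freeg_ind_dom0: (repr _) => [|k [m n] D _ _ PDD]; first by rewrite raddf0.
rewrite tensor_piD; apply: PD => //.
suff -> : << k *g (m, n) >> = k *: << (m, n) >> :> {freeg (M * N)%type / F}.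
  by rewrite linearZ /=; have := Pt (k *: m) n; rewrite linearZl_LR.
by apply/eqP/freeg_eqP => x; rewrite coeffZ !coeffU mul1r.
Qed.

Section Lift.
Variables (P : lmodType F) (f : {bilinear M -> N -> P}).

Definition tensor_prelift (u : {freeg (M * N)%type / F}) : P :=
  fglift (fun p => f p.1 p.2) u.

Fact tensor_prelift_additive : zmod_morphism tensor_prelift.
Proof. exact: lift_is_additive. Qed.
HB.instance Definition _ := GRing.isZmodMorphism.Build _ _ tensor_prelift
  tensor_prelift_additive.

Fact tensor_prelift_scalable : scalable tensor_prelift.
Proof.
move=> a u.
elim/freeg_ind_dom0: u => [|k p D _ _ IH]; first by rewrite !(scaler0, raddf0).
rewrite scalerDr 2!raddfD /= IH scalerDr; congr (_ + _).
suff -> : a *: << k *g p >> = << (a * k) *g p >> :> {freeg (M * N)%type / F}.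
  by rewrite /tensor_prelift !liftU scalerA.
by apply/eqP/freeg_eqP => x; rewrite coeffZ !coeffU mulrA.
Qed.
HB.instance Definition _ := GRing.isScalable.Build F _ P _ tensor_prelift
  tensor_prelift_scalable.

Let prelift_pair m n : tensor_prelift << (m, n) >> = f m n.
Proof. by rewrite /tensor_prelift liftU scale1r. Qed.

Let prelift_rel u : tensor_rel u -> tensor_prelift u = 0.
Proof.
elim=> [|||m m' n|m n n'|a m n|a m n].
- exact: raddf0.
- by move=> ? ? _ h _ h'; rewrite raddfD /= h h' addr0.
- by move=> ? ? _ h; rewrite linearZ /= h scaler0.
- by rewrite !raddfB /= !prelift_pair linearDl [X in X - _]addrAC
    subrr add0r subrr.
- by rewrite !raddfB /= !prelift_pair linearDr [X in X - _]addrAC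
    subrr add0r subrr.
- by rewrite raddfB /= linearZ /= !prelift_pair linearZl_LR subrr.
- by rewrite raddfB /= linearZ /= !prelift_pair linearZr_LR subrr.
Qed.

Definition tensor_lift (t : tensor) : P :=
  tensor_prelift (repr (t : Quotient.quot tensor_relb)).

Let tensor_lift_pi u : tensor_lift (tensor_pi u) = tensor_prelift u.
Proof.
apply/eqP; rewrite -subr_eq0 -raddfB; apply/eqP/prelift_rel/tensor_piP.
exact: tensor_reprK.
Qed.

Fact tensor_lift_linear : linear tensor_lift.
Proof.
move=> a s t; rewrite -[s]tensor_reprK -[t]tensor_reprK -linearP.
by rewrite !tensor_lift_pi linearP.
Qed.
HB.instance Definition _ := GRing.isLinear.Build F tensor P _ tensor_lift
  tensor_lift_linear.

Lemma tensor_liftE m n : tensor_lift (tens m n) = f m n.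
Proof. by rewrite tensor_lift_pi prelift_pair. Qed.

Lemma tensor_lift_unique (g : {linear tensor -> P}) :
  (forall m n, g (tens m n) = f m n) -> g =1 tensor_lift.
Proof.
move=> gE; elim/tensor_ind => [|s t hs ht|m n].
- by rewrite !raddf0.
- by rewrite !raddfD /= hs ht.
- by rewrite gE tensor_liftE.
Qed.

End Lift.
End TensorProduct.

Notation "m ⊗ n" := (tens m n) (at level 40, left associativity) : ring_scope.

Section TensorActions.
Variables (F : fieldType) (L M N : lmodType F).

Definition tensor_left_action (lM : {bilinear L -> M -> M})
    (lN : {bilinear L -> N -> N})
    (l : {bilinear L -> tensor M N -> tensor M N}) : Prop :=
  forall x m n, l x (m ⊗ n) = lM x m ⊗ n + m ⊗ lN x n.

Definition tensor_right_action (rM : {bilinear M -> L -> M})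
    (rN : {bilinear N -> L -> N})
    (r : {bilinear tensor M N -> L -> tensor M N}) : Prop :=
  forall x m n, r (m ⊗ n) x = rM m x ⊗ n + m ⊗ rN n x.

End TensorActions.

(* Main.v *)
(* On pure tensors both identities reduce to those of M and N: the mixed terms
   (x.m) ⊗ (y.n) and (y.m) ⊗ (x.n) cancel in (LLM), while in (LML) the mixed
   terms (x.m) ⊗ (n.y) and (m.y) ⊗ (x.n) agree on both sides and m ⊗ n
   acted on by xy has none. *)
From HB Require Import structures.
Require Import Defs.
From mathcomp Require Import all_boot all_order all_algebra.

Set Implicit Arguments.
Unset Strict Implicit.
Unset Printing Implicit Defensive.

Import GRing.Theory.
Local Open Scope ring_scope.

(** Pure tensors span [tensor M N]. This yields the uniqueness of both actions. *)
Lemma eq_linear_tensor (F : fieldType) (M N P : lmodType F)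
    (f g : {linear tensor M N -> P}) :
  (forall m n, f (m ⊗ n) = g (m ⊗ n)) -> f =1 g.
Proof.
move=> fg; elim/tensor_ind => [|s t hs ht|m n]; first by rewrite !raddf0.
  by rewrite !raddfD /= hs ht.
exact: fg.
Qed.

Section TensorSum.
Variables (F : fieldType) (M N : lmodType F).

Section Def.
Variables (a : {linear M -> M}) (b : {linear N -> N}).

(** Given on pairs so that the universal property carries it to the tensor product: well-definedness
    reduces to bilinearity. *)
Definition tens_sum (m : M) (n : N) : tensor M N := a m ⊗ n + m ⊗ b n.

Fact tens_sum_bilinear : bilinear_for *:%R *:%R tens_sum.
Proof.
split=> [n k m m'|m k n n'] /=.
  by rewrite /tens_sum linearP !linearPl scalerDr addrACA.
by rewrite /tens_sum linearP !linearPr scalerDr addrACA.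
Qed.

HB.instance Definition _ := bilinear_isBilinear.Build F M N (tensor M N)
  _ _ tens_sum tens_sum_bilinear.

(* [a ⊗ id + id ⊗ b] *)
Definition tensor_sum : {linear tensor M N -> tensor M N} :=
  tensor_lift tens_sum.

Lemma tensor_sumE m n : tensor_sum (m ⊗ n) = a m ⊗ n + m ⊗ b n.
Proof. exact: tensor_liftE. Qed.

End Def.

(** Makes the actions linear in their [L] argument: take for [a], [a1], [a2] the operators on [M] of
    [k *: x + y], [x], [y], and likewise on [N]. *)
Lemma tensor_sumP k (a a1 a2 : {linear M -> M}) (b b1 b2 : {linear N -> N}) :
    (forall m, a m = k *: a1 m + a2 m) -> (forall n, b n = k *: b1 n + b2 n) ->
  forall t, tensor_sum a b t = k *: tensor_sum a1 b1 t + tensor_sum a2 b2 t.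
Proof.
move=> aE bE; elim/tensor_ind => [|s t hs ht|m n].
- by rewrite !linear0 addr0.
- by rewrite !linearD hs ht addrACA.
- by rewrite !tensor_sumE aE bE linearPl linearPr scalerDr addrACA.
Qed.

End TensorSum.

Section Actions.
Variables (F : fieldType) (L M N : lmodType F).

Section Left.
Variables (lM : {bilinear L -> M -> M}) (lN : {bilinear L -> N -> N}).

Definition tensor_lact (x : L) (t : tensor M N) : tensor M N :=
  tensor_sum (lM x) (lN x) t.

Fact tensor_lact_bilinear : bilinear_for *:%R *:%R tensor_lact.
Proof.
split=> [t k x y|x k s t] /=; last exact: linearP.
by apply: tensor_sumP => u; exact: linearPl.
Qed.

HB.instance Definition _ := bilinear_isBilinear.Build F L (tensor M N)
  (tensor M N) _ _ tensor_lact tensor_lact_bilinear.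

Lemma tensor_lactE : tensor_left_action lM lN tensor_lact.
Proof. by move=> x m n; exact: tensor_sumE. Qed.

End Left.

Section Right.
Variables (rM : {bilinear M -> L -> M}) (rN : {bilinear N -> L -> N}).

(** [applyr] presents right multiplication by [x] as a linear endomorphism, so the construction of
    the left action applies again. *)
Definition tensor_ract (t : tensor M N) (x : L) : tensor M N :=
  tensor_sum (applyr rM x) (applyr rN x) t.

Fact tensor_ract_bilinear : bilinear_for *:%R *:%R tensor_ract.
Proof.
split=> [x k s t|t k x y] /=; first exact: linearP.
by apply: tensor_sumP => u; exact: linearPr.
Qed.

HB.instance Definition _ := bilinear_isBilinear.Build F (tensor M N) L
  (tensor M N) _ _ tensor_ract tensor_ract_bilinear.

Lemma tensor_ractE : tensor_right_action rM rN tensor_ract.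
Proof. by move=> x m n; exact: tensor_sumE. Qed.

End Right.

Variable mul : {bilinear L -> L -> L}.
Variables (lM : {bilinear L -> M -> M}) (rM : {bilinear M -> L -> M}).
Variables (lN : {bilinear L -> N -> N}) (rN : {bilinear N -> L -> N}).
Variable l : {bilinear L -> tensor M N -> tensor M N}.
Variable r : {bilinear tensor M N -> L -> tensor M N}.
Hypothesis lE : tensor_left_action lM lN l.
Hypothesis rE : tensor_right_action rM rN r.

(** Both sides are additive in the tensor, so only bilinearity of [l] and its values on pure tensors
    enter, not how [l] was built. *)
Lemma tensor_LLM : LLM mul lM -> LLM mul lN -> LLM mul l.
Proof.
move=> hM hN x y; elim/tensor_ind => [|s t hs ht|m n].
- by rewrite !linear0r subrr.
- by rewrite !linearDr hs ht opprD addrACA.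
rewrite !lE !linearDr !lE hM hN linearBl linearBr.
(* Exchanging [x] and [y] swaps the two mixed terms; the second permutation undoes this, so both
   sums end in the same bracket and [subrr] removes it. *)
rewrite [X in _ = X - _](AC (2*2) ((1*4)*(2*3))).
rewrite [X in _ = _ - X](AC (2*2) ((1*4)*(3*2))).
by rewrite opprD [RHS]addrACA subrr addr0 opprD [RHS]addrACA.
Qed.

Lemma tensor_LML : LML mul lM rM -> LML mul lN rN -> LML mul l r.
Proof.
move=> hM hN x y; elim/tensor_ind => [|s t hs ht|m n].
- by rewrite !(linear0l, linear0r) subrr.
- by rewrite !(linearDl, linearDr) hs ht opprD addrACA.
rewrite !(lE, rE) linearDl linearDr !(lE, rE) hM hN linearBl linearBr.
(* On the left, each difference coming from [hM] or [hN] counts as one atom. The mixed terms occur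
   in opposite orders on the two sides, hence the different permutations. *)
rewrite [LHS](AC (2*2) ((1*4)*(2*3))).
rewrite [X in _ = X - _](AC (2*2) ((1*4)*(3*2))).
by rewrite [RHS]addrAC opprD [X in _ = X + _]addrACA.
Qed.

End Actions.

Theorem proposition3p3 (F : fieldType) (L : lmodType F)
    (mul : {bilinear L -> L -> L}) (M N : lmodType F)
    (lM : {bilinear L -> M -> M}) (rM : {bilinear M -> L -> M})
    (lN : {bilinear L -> N -> N}) (rN : {bilinear N -> L -> N}) :
  left_leibniz mul ->
  weak_bimodule mul lM rM ->
  weak_bimodule mul lN rN ->
  exists (l : {bilinear L -> tensor M N -> tensor M N})
         (r : {bilinear tensor M N -> L -> tensor M N}),
    [/\ tensor_left_action lM lN l,
        tensor_right_action rM rN r,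
        forall l' : {bilinear L -> tensor M N -> tensor M N},
          tensor_left_action lM lN l' -> l' =2 l,
        forall r' : {bilinear tensor M N -> L -> tensor M N},
          tensor_right_action rM rN r' -> r' =2 r
      & weak_bimodule mul l r].
Proof.
move=> _ [llM lmM] [llN lmN].
exists (tensor_lact lM lN), (tensor_ract rM rN).
split.
- exact: tensor_lactE.
- exact: tensor_ractE.
- move=> l' l'E x; apply: eq_linear_tensor => m n.
  by rewrite /= l'E tensor_lactE.
- move=> r' r'E t x.
  (* The tensor is the first argument here, so the linear maps to compare are the partial
     applications at [x]. *)
  apply: (@eq_linear_tensor _ _ _ _
    (applyr r' x) (applyr (tensor_ract rM rN) x)).
  by move=> m n /=; rewrite r'E tensor_ractE.
- split; first exact: (tensor_LLM (tensor_lactE _ _)).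
  exact: (tensor_LML (tensor_lactE _ _) (tensor_ractE _ _)).
Qed.
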